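(* Let $X$ be an effective connected simplicial set with abelian fundamental group $G$, let $n$ be a positive integer, and let $\tilde X$ be the universal cover of $X$, with its $\mathbb Z[G]$-module structure on chains and homology, as defined in the context. Write $G=\mathbb Z/t_1\mathbb Z\oplus\cdots\oplus\mathbb Z/t_l\mathbb Z\oplus\mathbb Z^f$, let $R=\mathbb Z[x_1,\bar x_1,\ldots,x_{l+f},\bar x_{l+f}]$, $I=(x_1\bar x_1-1,\ldots,x_{l+f}\bar x_{l+f}-1,\,x_1^{t_1}-1,\ldots,x_l^{t_l}-1)$, and let $\nu:\mathbb Z[G]\to R/I$ be the ring isomorphism sending the generator of the $i$-th cyclic summand of $G$ to $x_i$. For $j\in\{n-1,n,n+1\}$ let $\sigma^j_1,\ldots,\sigma^j_{m_j}$ be the non-degenerate $j$-simplices of $X$. For $q\in\{n,n+1\}$ let $M^q$ be the $m_{q-1}\times m_q$ matrix over $R/I$ with entries $$M^q_{i,j}=\sum_{0\le d<q,\ \partial_d\sigma^q_j=\sigma^{q-1}_i}(-1)^d\;+\;\begin{cases}(-1)^q\,\nu(\tau(\sigma^q_j)^{-1})&\text{if }\partial_q\sigma^q_j=\sigma^{q-1}_i,\\0&\text{otherwise.}\end{cases}$$ Let $N$ be a matrix over $R/I$ whose columns generate the right kernel of $M^n$. Then there is a matrix $R_1$ with $M^{n+1}=NR_1$, and for any such $R_1$ and any matrix $R_2$ whose columns generate the right kernel of $N$, the matrix obtained by stacking $R_1^T$ and $R_2^T$ is a presentation matrix of $H_n(\tilde X)$ as a $\mathbb Z[G]$-module (rows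 being relations among generators indexed by the columns); that is, if $N$ has $p$ columns, then $H_n(\tilde X)\cong(R/I)^p/L$, where $L$ is the submodule generated by the rows of $R_1^T$ and of $R_2^T$.
   Context: A simplicial set is effective if it has (algorithmically listed) finitely many non-degenerate simplices in each dimension. $X$ has faces $\partial_i$ and degeneracies $s_i$; $|X|$ is its geometric realization with base vertex $v_*$. Fix a maximal tree $T$ in the 1-skeleton of $X$ (a set of non-degenerate edges). $G=\pi_1(|X|,v_* )$ is identified with the group presented by one generator $g_e$ for each non-degenerate edge $e\notin T$ and one relation $g_{\partial_2\sigma}g_{\partial_0\sigma}g_{\partial_1\sigma}^{-1}=1$ for each non-degenerate 2-simplex $\sigma$, where $g_e=1$ for $e\in T$ and for degenerate edges. The map $\tau:X\to G$ on all simplices is: $\tau(v)=1$ for $v\in X_0$; $\tau(e)=g_e$ for edges (so $\tau(e)=1$ on $T$ and on degenerate edges); $\tau(\sigma)=\tau(\partial_0\sigma)$ in dimension $>1$. $\tilde X$ is the simplicial set $\tilde X_n=G\times X_n$, $\tilde s_i(g,\sigma)=(g,s_i\sigma)$, and, for $\sigma\in X_n$, $\tilde\partial_i(g,\sigma)=(g,\partial_i\sigma)$ for $i<n$, $\tilde\partial_n(g,\sigma)=(g\tau(\sigma)^{-1},\partial_n\sigma)$; its realization is the universal cover of $|X|$. The normalized chain group $C_n(\tilde X)$ is free abelian on $G\times X_n^{ND}$, where $X_n^{ND}$ is the set of non-degenerate $n$-simplices (degenerate simplices are zero), and is a free $\mathbb Z[G]$-module via $g\cdot(h,\sigma)=(gh,\sigma)$;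 the differential $\tilde d_n(g,\sigma)=\sum_{i=0}^{n-1}(-1)^i(g,\partial_i\sigma)+(-1)^n(g\tau(\sigma)^{-1},\partial_n\sigma)$ is $\mathbb Z[G]$-linear, so $H_n(\tilde X)$ is a $\mathbb Z[G]$-module. *)

(* Defs.v *)
From HB Require Import structures.
From mathcomp Require Import all_boot all_order all_algebra.
From mathcomp Require Import boolp.
From mathcomp.multinomials Require Import freeg mpoly.

Set Implicit Arguments.
Unset Strict Implicit.
Unset Printing Implicit Defensive.

Import GRing.Theory.
Local Open Scope ring_scope.
Local Open Scope quotient_scope.

(* Faces of an (n+1)-simplex are indexed by 'I_n.+2 and
   degeneracies of an n-simplex by 'I_n.+1; [lift ord0 j] is j + 1 and
   [widen_ord] leaves the index unchanged, so the five identities are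
   d_i d_(j+1) = d_j d_i            (i <= j),
   s_i s_j     = s_(j+1) s_i        (i <= j),
   d_i s_(j+1) = s_j d_i            (i <= j),
   d_i s_j     = id                 (i = j or i = j + 1),
   d_(i+1) s_j = s_j d_i            (j < i). *)
Record sset := SSet {
  simp :> nat -> choiceType;
  face : forall {n}, 'I_n.+2 -> simp n.+1 -> simp n;
  degen : forall {n}, 'I_n.+1 -> simp n -> simp n.+1;
  face_face : forall n (i j : 'I_n.+2) (x : simp n.+2), (i <= j)%N ->
    face i (face (fintype.lift ord0 j) x)
    = face j (face (widen_ord (leqnSn _) i) x);
  degen_degen : forall n (i j : 'I_n.+1) (x : simp n), (i <= j)%N ->
    degen (widen_ord (leqnSn _) i) (degen j x)
    = degen (fintype.lift ord0 j) (degen i x);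
  face_degen_lt : forall n (i : 'I_n.+2) (j : 'I_n.+1) (x : simp n.+1),
    (i <= j)%N ->
    face (widen_ord (leqnSn _) i) (degen (fintype.lift ord0 j) x)
    = degen j (face i x);
  face_degen_id : forall n (i : 'I_n.+2) (j : 'I_n.+1) (x : simp n),
    (i == j :> nat) || (i == j.+1 :> nat) -> face i (degen j x) = x;
  face_degen_gt : forall n (i : 'I_n.+2) (j : 'I_n.+1) (x : simp n.+1),
    (j < i)%N ->
    face (fintype.lift ord0 i) (degen (widen_ord (leqnSn _) j) x)
    = degen j (face i x)
}.

Arguments face {_ _} _ _.
Arguments degen {_ _} _ _.

Definition degenerate (X : sset) n : X n -> Prop :=
  match n with
  | 0 => fun _ => False
  | m.+1 => fun x => exists (i : 'I_m.+1) (y : X m), x = degen i y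
  end.

Record effective (X : sset) := Effective {
  nd : forall n, seq (X n);
  nd_uniq : forall n, uniq (nd n);
  mem_nd : forall n (x : X n), (x \in nd n) <-> ~ degenerate x
}.

Section Graph.
Variable X : sset.

(* [(e, true)] is the edge e traversed from its initial vertex d_1 e to its
   final vertex d_0 e, and [(e, false)] is e traversed backwards. *)
Definition src (a : X 1%N * bool) : X 0%N :=
  if a.2 then face (inord 1) a.1 else face ord0 a.1.
Definition tgt (a : X 1%N * bool) : X 0%N :=
  if a.2 then face ord0 a.1 else face (inord 1) a.1.

Fixpoint walk (v w : X 0%N) (p : seq (X 1%N * bool)) : Prop :=
  if p is a :: p' then src a = v /\ walk (tgt a) w p' else v = w.

(* X is connected iff |X| is: nonempty, and any two vertices are joined in the
   1-skeleton. *)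
Definition connected : Prop :=
  inhabited (X 0%N) /\ forall v w : X 0%N, exists p, walk v w p.

(* T is a tree through all the vertices of X, the last clause saying that it
   contains no circuit. *)
Definition maximal_tree (T : pred (X 1%N)) : Prop :=
  [/\ forall e, T e -> ~ degenerate e,
      forall v w : X 0%N, exists2 p, all (fun a => T a.1) p & walk v w p
    & forall v p, all (fun a => T a.1) p -> uniq [seq a.1 | a <- p] ->
        walk v v p -> p = [::]].
End Graph.

(* The group presented by generators S and relators r = 1 for [rels r].  A word
   is a list of letters, [(s, true)] for s and [(s, false)] for s^-1. *)
Section PresentedGroup.
Variables (S : choiceType) (rels : seq (S * bool) -> Prop).
Local Notation word := (seq (S * bool)).

Inductive word_eq : word -> word -> Prop :=
| word_refl u : word_eq u u
| word_sym u v : word_eq u v -> word_eq v u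
| word_trans u v w : word_eq u v -> word_eq v w -> word_eq u w
| word_cancel u s b v : word_eq (u ++ (s, b) :: (s, ~~ b) :: v) (u ++ v)
| word_rel u r v : rels r -> word_eq (u ++ r ++ v) (u ++ v).

Definition inv_word (u : word) : word := rev [seq (a.1, ~~ a.2) | a <- u].

Definition word_eqb (u v : word) : bool := `[< word_eq u v >].

Lemma word_eqb_equiv : equiv_class_of word_eqb.
Proof.
split=> [u|u v|v u w]; first by apply/asboolP; exact: word_refl.
  by apply/asboolP/asboolP; exact: word_sym.
by move=> /asboolP uv /asboolP vw; apply/asboolP; exact: word_trans uv vw.
Qed.

Canonical word_eqb_rel := EquivRelPack word_eqb_equiv.
Canonical word_eqb_enc := defaultEncModRel word_eqb.

Definition pres_group := {eq_quot word_eqb}.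

HB.instance Definition _ : EqQuotient word word_eqb pres_group :=
  EqQuotient.on pres_group.
HB.instance Definition _ := Choice.on pres_group.

Definition pres_class (u : word) : pres_group := \pi u.

Lemma pres_classP u v : pres_class u = pres_class v <-> word_eq u v.
Proof. by split=> [/eqmodP/asboolP|h] //; apply/eqmodP/asboolP. Qed.

Lemma pres_repr (x : pres_group) : pres_class (repr x) = x.
Proof. exact: reprK. Qed.

Lemma word_eq_cat u u' v v' :
  word_eq u u' -> word_eq v v' -> word_eq (u ++ v) (u' ++ v').
Proof.
move=> hu hv; apply: (@word_trans _ (u' ++ v)).
  elim: hu => {u u' hv}[u|u w _|u w z _ h1 _ h2|u s b w|u r w hr].
  - exact: word_refl.
  - exact: word_sym.
  - exact: word_trans h1 h2.
  - by rewrite -!catA /=; exact: word_cancel.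
  - by rewrite -!catA /=; exact: word_rel.
elim: hv => {u v v' hu}[u|u w _|u w z _ h1 _ h2|u s b w|u r w hr].
- exact: word_refl.
- exact: word_sym.
- exact: word_trans h1 h2.
- by rewrite !catA; exact: word_cancel.
- by rewrite !(catA u'); exact: word_rel.
Qed.

Lemma inv_wordK : involutive inv_word.
Proof.
move=> u; rewrite /inv_word map_rev revK -map_comp.
by rewrite -[RHS]map_id; apply: eq_map => -[s b] /=; rewrite negbK.
Qed.

Lemma inv_word_cat u v : inv_word (u ++ v) = inv_word v ++ inv_word u.
Proof. by rewrite /inv_word map_cat rev_cat. Qed.

Lemma word_mulV u : word_eq (u ++ inv_word u) [::].
Proof.
elim/last_ind: u => [|u [s b] IHu]; first exact: word_refl.
rewrite -cats1 inv_word_cat -catA [_ ++ _ ++ _]/=.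
exact: word_trans (word_cancel _ _ _ _) IHu.
Qed.

Lemma word_mulVl u : word_eq (inv_word u ++ u) [::].
Proof. by rewrite -{2}[u]inv_wordK; exact: word_mulV. Qed.

Lemma word_eq_inv u v : word_eq u v -> word_eq (inv_word u) (inv_word v).
Proof.
move=> uv; apply: (@word_trans _ (inv_word u ++ v ++ inv_word v)).
  rewrite -{1}[inv_word u]cats0; apply: word_eq_cat; first exact: word_refl.
  exact/word_sym/word_mulV.
rewrite catA -{2}[inv_word v]cat0s.
apply: word_eq_cat; last exact: word_refl.
apply: word_trans (word_mulVl u).
by apply: word_eq_cat; [exact: word_refl | exact: word_sym].
Qed.

Definition pres_one : pres_group := pres_class [::].
Definition pres_mul (x y : pres_group) := pres_class (repr x ++ repr y).
Definition pres_inv (x : pres_group) := pres_class (inv_word (repr x)).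

Lemma repr_class u : word_eq (repr (pres_class u)) u.
Proof. by apply/pres_classP; rewrite pres_repr. Qed.

Lemma pres_class_cat u v :
  pres_class (u ++ v) = pres_mul (pres_class u) (pres_class v).
Proof.
by apply/pres_classP/word_sym; apply: word_eq_cat; exact: repr_class.
Qed.

Lemma pres_class_inv u : pres_class (inv_word u) = pres_inv (pres_class u).
Proof. by apply/pres_classP/word_sym/word_eq_inv/repr_class. Qed.

Lemma pres_mulA : associative pres_mul.
Proof.
move=> x y z; rewrite -[x]pres_repr -[y]pres_repr -[z]pres_repr.
by rewrite -!pres_class_cat catA.
Qed.
Lemma pres_mul1 : left_id pres_one pres_mul.
Proof. by move=> x; rewrite -[x]pres_repr -pres_class_cat. Qed.
Lemma pres_mulr1 : right_id pres_one pres_mul.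
Proof. by move=> x; rewrite -[x]pres_repr -pres_class_cat cats0. Qed.
Lemma pres_mulV : left_inverse pres_one pres_inv pres_mul.
Proof.
move=> x; rewrite -[x]pres_repr -pres_class_inv -pres_class_cat.
exact/pres_classP/word_mulVl.
Qed.
Lemma pres_mulrV : right_inverse pres_one pres_inv pres_mul.
Proof.
move=> x; rewrite -[x]pres_repr -pres_class_inv -pres_class_cat.
exact/pres_classP/word_mulV.
Qed.

HB.instance Definition _ := isGroup.Build pres_group
  pres_mulA pres_mul1 pres_mulr1 pres_mulV pres_mulrV.

End PresentedGroup.

Section FundamentalGroup.
Variables (X : sset) (E : effective X) (T : pred (X 1%N)).

Definition pi1_gen := {e : X 1%N | (e \in nd E 1) && ~~ T e}.

(* The one-letter word e if e is a generator; the empty word if e lies in T or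
   is degenerate. *)
Definition edge_word (e : X 1%N) : seq (pi1_gen * bool) :=
  if insub e is Some e' then [:: (e', true)] else [::].

Definition pi1_rel (r : seq (pi1_gen * bool)) : Prop :=
  exists2 s : X 2%N, s \in nd E 2 &
    r = edge_word (face (inord 2) s) ++ edge_word (face ord0 s)
        ++ inv_word (edge_word (face (inord 1) s)).

Definition pi1 := pres_group pi1_rel.
HB.instance Definition _ := monoid.Group.on pi1.

Definition edge_class (e : X 1%N) : pi1 := pres_class pi1_rel (edge_word e).

Fixpoint tau n : X n -> pi1 :=
  match n with
  | 0 => fun _ => 1%g
  | k.+1 =>
    match k return (X k -> pi1) -> X k.+1 -> pi1 with
    | 0 => fun _ => edge_class
    | _.+1 => fun tau_k s => tau_k (face ord0 s)
    end (@tau k)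
  end.

Arguments tau : simpl never.

Lemma edge_class_degen (e : X 1%N) : degenerate e -> edge_class e = 1%g.
Proof.
move=> de; rewrite /edge_class /edge_word insubN // negb_and.
by apply/orP; left; apply/negP => /mem_nd.
Qed.

Lemma edge_class_rel (s : X 2%N) :
  (edge_class (face (inord 2) s) * edge_class (face ord0 s)
   = edge_class (face (inord 1) s))%g.
Proof.
have [sE|sE] := boolP (s \in nd E 2).
  apply: (mulIg (edge_class (face (inord 1) s))^-1%g); rewrite mulgV -mulgA.
  rewrite -[RHS]/(pres_class _ [::]) [LHS](_ : _ = pres_class pi1_rel
    (edge_word (face (inord 2) s) ++ edge_word (face ord0 s)
     ++ inv_word (edge_word (face (inord 1) s)))); last first.
    by rewrite !pres_class_cat pres_class_inv.
  apply/pres_classP; have := @word_rel _ pi1_rel [::] _ [::].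
  by rewrite /= => /(_ _ (ex_intro2 _ _ s sE erefl)); rewrite cats0.
have [i [e ->]] : degenerate s.
  by apply: contrapT => /(mem_nd E) sE'; rewrite sE' in sE.
have i1 : inord 1 = ord_max :> 'I_2 by apply/val_inj; rewrite /= inordK.
have hid k : (k == i :> nat) || (k == i.+1 :> nat) ->
  face (inord k) (degen i e) = e.
  move=> hk; have k3 : (k < 3)%N by case/orP: hk => /eqP->; case: i => -[|[]].
  by apply: face_degen_id; rewrite inordK.
have o0 : ord0 = inord 0 :> 'I_3 by apply/val_inj; rewrite /= inordK.
case: i hid => -[|[|//]] hi hid.
  rewrite o0 (hid 0%N isT) (hid 1%N isT).
  rewrite [inord 2](_ : _ = fintype.lift ord0 ord_max); last first.
    by apply/val_inj; rewrite /= inordK.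
  rewrite [Ordinal hi](_ : _ = widen_ord (leqnSn _) (ord0 : 'I_1)); last first.
    exact/val_inj.
  by rewrite face_degen_gt // edge_class_degen ?mul1g //; do 2 eexists.
rewrite (hid 1%N isT) (hid 2 isT).
rewrite [ord0](_ : _ = widen_ord (leqnSn _) (ord0 : 'I_2)); last first.
  exact/val_inj.
rewrite [Ordinal hi](_ : _ = fintype.lift ord0 (ord0 : 'I_1)); last exact/val_inj.
by rewrite face_degen_lt // [X in (_ * X)%g]edge_class_degen ?mulg1 //; do 2 eexists.
Qed.

Lemma tauS n (x : X n.+2) : tau x = tau (face ord0 x).
Proof. by []. Qed.

Lemma face_faceE n (i j : 'I_n.+2) (i' j' : 'I_n.+3) (x : X n.+2) :
    (i <= j)%N -> i' = i :> nat -> j' = j.+1 :> nat ->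
  face i (face j' x) = face j (face i' x).
Proof.
move=> ij ii jj; rewrite (_ : j' = fintype.lift ord0 j); last exact/val_inj.
rewrite face_face //; congr (face _ (face _ _)); exact/val_inj.
Qed.

Lemma tau_face n (i : 'I_n.+3) (x : X n.+2) :
  (i <= n)%N -> tau (face i x) = tau x.
Proof.
elim: n i x => [|n IHn] i x hi.
  by rewrite tauS; congr (tau (face _ _)); apply/val_inj => /=; case: (val i) hi.
case: i hi => -[|i] hi lin.
  by rewrite tauS [RHS]tauS; congr (tau (face _ (face _ _))); apply/val_inj.
rewrite tauS [RHS]tauS -(IHn (inord i) (face ord0 x)) ?inordK //.
by congr tau; apply: face_faceE; rewrite //= inordK.
Qed.

Lemma tau_face_last n (x : X n.+2) :
  (tau (face ord_max x) * tau x = tau (face (inord n.+1) x))%g.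
Proof.
elim: n x => [|n IHn] x.
  rewrite tauS -[RHS]edge_class_rel; congr (tau (face _ _) * _)%g.
  by apply/val_inj; rewrite /= inordK.
rewrite [in LHS]tauS [X in (_ * X)%g]tauS [RHS]tauS.
rewrite (@face_faceE _ ord0 ord_max ord0 ord_max) // IHn; congr tau.
by apply/esym/face_faceE; rewrite // !inordK.
Qed.

Lemma tau_degen_last n (x : X n) : tau (degen ord_max x) = 1%g.
Proof.
elim: n x => [|n IHn] x; first by apply: edge_class_degen; do 2 eexists.
rewrite tauS [ord0](_ : _ = widen_ord (leqnSn _) (ord0 : 'I_n.+2)); last first.
  exact/val_inj.
rewrite [ord_max](_ : _ = fintype.lift ord0 ord_max); last exact/val_inj.
by rewrite face_degen_lt.
Qed.

Lemma tau_degen n (j : 'I_n.+1) (x : X n.+1) :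
  tau (degen (widen_ord (leqnSn _) j) x) = tau x.
Proof.
elim: n j x => [|n IHn] j x; rewrite tauS.
  by rewrite face_degen_id //= ord1.
case: j => -[|j] hj; first by rewrite face_degen_id.
rewrite [ord0](_ : _ = widen_ord (leqnSn _) (ord0 : 'I_n.+3)); last first.
  exact/val_inj.
rewrite [widen_ord _ (Ordinal _)](_ : _ =
  fintype.lift ord0 (widen_ord (leqnSn _) (Ordinal (hj : (j < n.+1)%N)))).
  by rewrite face_degen_lt // IHn.
exact/val_inj.
Qed.

Definition cover_simp n : choiceType := (pi1 * X n)%type.

Definition cover_face n (i : 'I_n.+2) (y : cover_simp n.+1) : cover_simp n :=
  (if i == ord_max then (y.1 * (tau y.2)^-1)%g else y.1, face i y.2).

Definition cover_degen n (i : 'I_n.+1) (y : cover_simp n) : cover_simp n.+1 :=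
  (y.1, degen i y.2).

Lemma lift0_max n (i : 'I_n.+1) : (fintype.lift ord0 i == ord_max) = (i == ord_max).
Proof. by rewrite -!val_eqE /= /bump leq0n add1n eqSS. Qed.

Lemma widen_max n (i : 'I_n.+1) : (widen_ord (leqnSn _) i == ord_max) = false.
Proof. by rewrite -val_eqE /= ltn_eqF. Qed.

Lemma neq_max n (i : 'I_n.+1) : i != ord_max -> (i < n)%N.
Proof. by rewrite -val_eqE /= ltn_neqAle -ltnS ltn_ord andbT. Qed.

Lemma cover_face_face n (i j : 'I_n.+2) (y : cover_simp n.+2) : (i <= j)%N ->
  cover_face i (cover_face (fintype.lift ord0 j) y)
  = cover_face j (cover_face (widen_ord (leqnSn _) i) y).
Proof.
move=> ij; case: y => g x; congr (_, _) => /=; last exact: face_face.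
rewrite lift0_max widen_max; have [->|jM] := eqVneq j ord_max; last first.
  rewrite ifN // -val_eqE ltn_eqF //=.
  exact: leq_ltn_trans ij (neq_max jM).
have -> : fintype.lift ord0 ord_max = ord_max :> 'I_n.+3 by exact/val_inj.
have [->|iM] := eqVneq i ord_max; last first.
  by rewrite tau_face //= -ltnS; exact: neq_max.
rewrite -mulgA -invgM tau_face_last; congr (g * (tau (face _ _))^-1)%g.
by apply/val_inj; rewrite /= inordK.
Qed.

Lemma cover_degen_degen n (i j : 'I_n.+1) (y : cover_simp n) : (i <= j)%N ->
  cover_degen (widen_ord (leqnSn _) i) (cover_degen j y)
  = cover_degen (fintype.lift ord0 j) (cover_degen i y).
Proof. by move=> ij; congr (_, _); exact: degen_degen. Qed.

Lemma cover_face_degen_lt n (i : 'I_n.+2) (j : 'I_n.+1) (y : cover_simp n.+1) :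
  (i <= j)%N ->
  cover_face (widen_ord (leqnSn _) i) (cover_degen (fintype.lift ord0 j) y)
  = cover_degen j (cover_face i y).
Proof.
move=> ij; congr (_, _); last exact: face_degen_lt.
by rewrite widen_max /= -val_eqE ltn_eqF //=; apply: leq_ltn_trans ij _.
Qed.

Lemma cover_face_degen_id n (i : 'I_n.+2) (j : 'I_n.+1) (y : cover_simp n) :
  (i == j :> nat) || (i == j.+1 :> nat) ->
  cover_face i (cover_degen j y) = y.
Proof.
move=> ij; case: y => g x; congr (_, _) => /=; last exact: face_degen_id.
case: eqP => // iM; rewrite (_ : j = ord_max) ?tau_degen_last ?invg1 ?mulg1 //.
apply/val_inj => /=; move: ij; rewrite iM /= => /orP[/eqP h|/eqP[]//].
by move: (ltn_ord j); rewrite -h ltnn.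
Qed.

Lemma cover_face_degen_gt n (i : 'I_n.+2) (j : 'I_n.+1) (y : cover_simp n.+1) :
  (j < i)%N ->
  cover_face (fintype.lift ord0 i) (cover_degen (widen_ord (leqnSn _) j) y)
  = cover_degen j (cover_face i y).
Proof.
move=> ij; congr (_, _); last exact: face_degen_gt.
by rewrite /= lift0_max tau_degen.
Qed.

Definition cover : sset :=
  SSet cover_face_face cover_degen_degen cover_face_degen_lt
       cover_face_degen_id cover_face_degen_gt.

End FundamentalGroup.

(* The additive extension of f : K -> V to the free abelian group on K; [fglift]
   needs a module as its target, and [zmodule V] is V as a Z-module. *)
Section FreeLift.
Variables (K : choiceType) (V : zmodType).

Definition zlift (f : K -> V) (c : {freeg K}) : V :=
  fglift (f : K -> zmodule V) c.

Lemma zliftU f k : zlift f << k >> = f k.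
Proof. by rewrite /zlift liftU scale1r. Qed.

Lemma zlift_is_zmod_morphism f : zmod_morphism (zlift f).
Proof. exact: (@lift_is_additive int K (zmodule V) f). Qed.

HB.instance Definition _ f :=
  GRing.isZmodMorphism.Build {freeg K} V (zlift f) (zlift_is_zmod_morphism f).

Lemma freeg_sub_ind (P : {freeg K} -> Prop) :
  P 0 -> (forall k, P << k >>) -> (forall a b, P a -> P b -> P (a - b)) ->
  forall c, P c.
Proof.
move=> P0 PU PB; have PN a : P a -> P (- a).
  by move=> Pa; rewrite -sub0r; exact: PB.
have PD a b : P a -> P b -> P (a + b).
  by move=> Pa Pb; rewrite -[b]opprK; exact/PB/PN.
have PM n a : P a -> P (a *+ n).
  by move=> Pa; elim: n => [|n IHn] //; rewrite mulrS; exact: PD.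
elim/freeg_ind_dom0 => // z k D _ _ PDD; apply: (PD) => //.
have -> : << z *g k >> = << k >> *~ z :> {freeg K}.
  apply/eqP/freeg_eqP => k'; rewrite raddfMz /= !coeffU mul1r.
  by rewrite -mulrzr mulrC intz.
by case: z => z; [exact: PM | exact/PN/PM].
Qed.

Lemma zlift_fun0 c : zlift (fun=> 0) c = 0.
Proof.
elim/freeg_sub_ind: c => [|k|a b ha hb]; first exact: raddf0.
  exact: zliftU.
by rewrite raddfB /= ha hb subr0.
Qed.

Lemma zlift_funB f g c : zlift (fun k => f k - g k) c = zlift f c - zlift g c.
Proof.
elim/freeg_sub_ind: c => [|k|a b ha hb]; first by rewrite !raddf0 addr0.
  by rewrite !zliftU.
rewrite (raddfB (zlift f)) (raddfB (zlift g)) (raddfB (zlift _)) /= ha hb.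
by rewrite !opprD addrACA.
Qed.

Lemma eq_zlift f g : f =1 g -> zlift f =1 zlift g.
Proof.
move=> fg; elim/freeg_sub_ind => [|k|a b ha hb]; first by rewrite !raddf0.
  by rewrite !zliftU.
by rewrite (raddfB (zlift f)) (raddfB (zlift g)) /= ha hb.
Qed.
End FreeLift.

Section FreePair.
Variables (K L : choiceType) (V : zmodType) (op : K -> L -> V).

Definition zpair (a : {freeg K}) (b : {freeg L}) : V :=
  zlift (fun k => zlift (op k) b) a.

Lemma zpairU k l : zpair << k >> << l >> = op k l.
Proof. by rewrite /zpair !zliftU. Qed.

Lemma zpair0l b : zpair 0 b = 0. Proof. exact: raddf0. Qed.
Lemma zpairBl a a' b : zpair (a - a') b = zpair a b - zpair a' b.
Proof. exact: raddfB. Qed.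
Lemma zpair0r a : zpair a 0 = 0.
Proof.
rewrite -[RHS](zlift_fun0 _ a); apply: eq_zlift => k; exact: raddf0.
Qed.
Lemma zpairBr a b b' : zpair a (b - b') = zpair a b - zpair a b'.
Proof.
rewrite -[RHS]zlift_funB; apply: eq_zlift => k; exact: raddfB.
Qed.
Lemma zpairDl a a' b : zpair (a + a') b = zpair a b + zpair a' b.
Proof. exact: raddfD. Qed.
Lemma zpairDr a b b' : zpair a (b + b') = zpair a b + zpair a b'.
Proof.
rewrite -[b' in LHS]opprK zpairBr -[- b']sub0r zpairBr zpair0r.
by rewrite sub0r opprK.
Qed.
End FreePair.

(* The integral group ring Z[G], with << g >> * << h >> = << g h >>. *)
Definition group_ring (G : groupType) : Type := {freeg G}.

Section GroupRing.
Variable G : groupType.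

HB.instance Definition _ := GRing.Zmodule.copy (group_ring G) {freeg G}.

Definition gr_elt (g : G) : group_ring G := << g >>.

Definition gr_one : group_ring G := gr_elt 1%g.
Definition gr_mul (a b : group_ring G) : group_ring G :=
  zpair (fun g h => gr_elt (g * h)%g) a b.

Lemma gr_mulA : associative gr_mul.
Proof.
elim/freeg_sub_ind => [||a a' ha ha'] => [y z|g|y z].
- by rewrite /gr_mul !zpair0l.
- elim/freeg_sub_ind => [||b b' hb hb'] => [z|h|z].
  + by rewrite /gr_mul !(zpair0l, zpair0r).
  + elim/freeg_sub_ind => [|k|c c' hc hc'].
    * by rewrite /gr_mul !zpair0r.
    * by rewrite /gr_mul !zpairU mulgA.
    * by move: hc hc'; rewrite /gr_mul !zpairBr => -> ->.
  + by move: (hb z) (hb' z); rewrite /gr_mul !(zpairBr, zpairBl) => -> ->.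
- by move: (ha y z) (ha' y z); rewrite /gr_mul !zpairBl => -> ->.
Qed.

Lemma gr_mul1 : left_id gr_one gr_mul.
Proof.
elim/freeg_sub_ind => [|k|c c' hc hc'].
- by rewrite /gr_mul zpair0r.
- by rewrite /gr_mul zpairU mul1g.
- by move: hc hc'; rewrite /gr_mul zpairBr => -> ->.
Qed.

Lemma gr_mulr1 : right_id gr_one gr_mul.
Proof.
elim/freeg_sub_ind => [|k|c c' hc hc'].
- by rewrite /gr_mul zpair0l.
- by rewrite /gr_mul zpairU mulg1.
- by move: hc hc'; rewrite /gr_mul zpairBl => -> ->.
Qed.

Lemma gr_mulDl : left_distributive gr_mul +%R.
Proof. by move=> a b c; exact: zpairDl. Qed.

Lemma gr_mulDr : right_distributive gr_mul +%R.
Proof. by move=> a b c; exact: zpairDr. Qed.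

Lemma gr_one_neq0 : gr_one != 0.
Proof.
apply/eqP => /(congr1 (coeff (1%g : G))).
by rewrite coeff0 /gr_one /gr_elt coeffU eqxx.
Qed.

HB.instance Definition _ := GRing.Zmodule_isNzRing.Build (group_ring G)
  gr_mulA gr_mul1 gr_mulr1 gr_mulDl gr_mulDr gr_one_neq0.

Lemma gr_sub_ind (P : group_ring G -> Prop) :
  P 0 -> (forall g, P (gr_elt g)) -> (forall a b, P a -> P b -> P (a - b)) ->
  forall a, P a.
Proof. exact: freeg_sub_ind. Qed.

Lemma gr_eltM g h : gr_elt (g * h)%g = gr_elt g * gr_elt h.
Proof. by rewrite [RHS]zpairU. Qed.
End GroupRing.

(* The free abelian group on G x S, with g (h, s) = (g h, s). *)
Definition free_mod (G : groupType) (S : choiceType) : Type := {freeg (G * S)%type}.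

Section FreeMod.
Variables (G : groupType) (S : choiceType).

HB.instance Definition _ :=
  GRing.Zmodule.copy (free_mod G S) {freeg (G * S)%type}.

Definition fm_elt (y : G * S) : free_mod G S := << y >>.

Definition fm_scale (a : group_ring G) (c : free_mod G S) : free_mod G S :=
  zpair (fun g (y : G * S) => fm_elt ((g * y.1)%g, y.2)) a c.

Lemma fm_scaleA a b c : fm_scale a (fm_scale b c) = fm_scale (a * b) c.
Proof.
move: a b c; elim/freeg_sub_ind => [||a a' ha ha'] => [y z|g|y z].
- by rewrite mul0r /fm_scale !zpair0l.
- elim/freeg_sub_ind => [||b b' hb hb'] => [z|h|z].
  + by rewrite mulr0 /fm_scale !(zpair0l, zpair0r).
  + elim/freeg_sub_ind => [|k|c c' hc hc'].
    * by rewrite /fm_scale !zpair0r.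
    * by rewrite -[_ * _]gr_eltM /fm_scale !zpairU mulgA.
    * by move: hc hc'; rewrite /fm_scale !zpairBr => -> ->.
  + rewrite mulrBr; move: (hb z) (hb' z).
    by rewrite /fm_scale !(zpairBr, zpairBl) => -> ->.
- rewrite mulrBl; move: (ha y z) (ha' y z).
  by rewrite /fm_scale !zpairBl => -> ->.
Qed.

Lemma fm_scale1 : left_id 1 fm_scale.
Proof.
elim/freeg_sub_ind => [|k|c c' hc hc'].
- by rewrite /fm_scale zpair0r.
- by case: k => g s; rewrite /fm_scale zpairU mul1g.
- by move: hc hc'; rewrite /fm_scale zpairBr => -> ->.
Qed.

Lemma fm_scaleDr : right_distributive fm_scale +%R.
Proof. by move=> a c c'; exact: zpairDr. Qed.

Lemma fm_scaleDl c : {morph fm_scale^~ c : a b / a + b}.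
Proof. by move=> a b; exact: zpairDl. Qed.

HB.instance Definition _ := GRing.Zmodule_isLmodule.Build (group_ring G)
  (free_mod G S) fm_scaleA fm_scale1 fm_scaleDr fm_scaleDl.

Lemma fm_sub_ind (P : free_mod G S -> Prop) :
  P 0 -> (forall y, P (fm_elt y)) -> (forall a b, P a -> P b -> P (a - b)) ->
  forall c, P c.
Proof. exact: freeg_sub_ind. Qed.

Lemma fm_eltZ g y : gr_elt g *: fm_elt y = fm_elt ((g * y.1)%g, y.2).
Proof. exact: zpairU. Qed.
End FreeMod.

Section Modules.
Variable R : nzRingType.

Section Image.
Variables (U V : lmodType R) (f : {linear U -> V}).

Definition im_pred : {pred V} := fun v => `[< exists u, v = f u >].

Lemma im_closed : submod_closed im_pred.
Proof.
split; first by apply/asboolP; exists 0; rewrite raddf0.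
move=> a _ _ /asboolP[u ->] /asboolP[u' ->]; apply/asboolP.
by exists (a *: u + u'); rewrite linearP.
Qed.

HB.instance Definition _ := GRing.isSubmodClosed.Build R V im_pred im_closed.
End Image.

Section Kernel.
Variables (V W : lmodType R) (f : {linear V -> W}).

Definition ker_pred : {pred V} := fun v => f v == 0.

Lemma ker_closed : submod_closed ker_pred.
Proof.
split; first by rewrite unfold_in /ker_pred raddf0.
move=> a u v; rewrite !unfold_in /ker_pred linearP => /eqP-> /eqP->.
by rewrite scaler0 addr0.
Qed.

HB.instance Definition _ := GRing.isSubmodClosed.Build R V ker_pred ker_closed.

Record ker := Ker { ker_val : V; ker_valP : ker_val \in ker_pred }.

HB.instance Definition _ := [isSub for ker_val].
HB.instance Definition _ := [Choice of ker by <:].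
HB.instance Definition _ := [SubChoice_isSubLmodule of ker by <:].
End Kernel.

Section QuotMod.
Variables (V : lmodType R) (S : submodClosed V).

Definition submod_pred : {pred V} := S.

Lemma submod_pred_closed : zmod_closed submod_pred.
Proof.
split=> [|u v Su Sv]; first exact: rpred0.
by rewrite -scaleN1r; apply: rpredD => //; exact: rpredZ.
Qed.

HB.instance Definition _ :=
  GRing.isZmodClosed.Build V submod_pred submod_pred_closed.

Definition quot_mod : Type := {ideal_quot submod_pred}.

HB.instance Definition _ := GRing.Zmodule.copy quot_mod {ideal_quot submod_pred}.

Definition quot_pi (v : V) : quot_mod := \pi_({ideal_quot submod_pred}) v.

Definition quot_scale (a : R) (x : quot_mod) : quot_mod :=
  quot_pi (a *: repr (x : {ideal_quot submod_pred})).

Lemma quot_piP u v : quot_pi u = quot_pi v <-> u - v \in S.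
Proof.
rewrite (_ : (u - v \in S) = (u == v %[mod {ideal_quot submod_pred}])).
  by split=> /eqP.
by rewrite -Quotient.idealrBE.
Qed.

Lemma quot_pi_repr (x : quot_mod) :
  quot_pi (repr (x : {ideal_quot submod_pred})) = x.
Proof. exact: reprK. Qed.

Lemma quot_piD u v : quot_pi (u + v) = quot_pi u + quot_pi v.
Proof. exact: raddfD. Qed.

Lemma quot_piZ a v : quot_pi (a *: v) = quot_scale a (quot_pi v).
Proof.
apply/quot_piP; rewrite -scalerBr; apply/rpredZ/quot_piP.
by rewrite quot_pi_repr.
Qed.

Lemma quot_scaleA a b x : quot_scale a (quot_scale b x) = quot_scale (a * b) x.
Proof. by rewrite -[x]quot_pi_repr -!quot_piZ scalerA. Qed.
Lemma quot_scale1 : left_id 1 quot_scale.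
Proof. by move=> x; rewrite -[x]quot_pi_repr -!quot_piZ scale1r. Qed.
Lemma quot_scaleDr : right_distributive quot_scale +%R.
Proof.
move=> a x y; rewrite -[x]quot_pi_repr -[y]quot_pi_repr -quot_piD -!quot_piZ.
by rewrite scalerDr quot_piD.
Qed.
Lemma quot_scaleDl x : {morph quot_scale^~ x : a b / a + b}.
Proof.
by move=> a b; rewrite -[x]quot_pi_repr -!quot_piZ scalerDl quot_piD.
Qed.

HB.instance Definition _ := GRing.Zmodule_isLmodule.Build R quot_mod
  quot_scaleA quot_scale1 quot_scaleDr quot_scaleDl.

Lemma quot_pi_is_linear : linear quot_pi.
Proof. by move=> a u v; rewrite quot_piD quot_piZ. Qed.

HB.instance Definition _ :=
  GRing.isLinear.Build R V quot_mod *:%R quot_pi quot_pi_is_linear.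
End QuotMod.

(* ker f / im g, written as ker f / (ker f :&: im g) so as not to depend on a
   proof of f \o g = 0. *)
Section HomologyOf.
Variables (U V W : lmodType R) (g : {linear U -> V}) (f : {linear V -> W}).

Definition bound_pred : {pred ker f} := fun z => ker_val z \in im_pred g.

Lemma bound_closed : submod_closed bound_pred.
Proof.
split=> [|a u v].
  by suff: val (0 : ker f) \in im_pred g by []; rewrite raddf0 rpred0.
rewrite !unfold_in => hu hv.
suff: val (a *: u + v) \in im_pred g by [].
by rewrite linearP rpredD ?rpredZ.
Qed.

HB.instance Definition _ :=
  GRing.isSubmodClosed.Build R (ker f) bound_pred bound_closed.

Definition homology_of := quot_mod bound_pred.
HB.instance Definition _ := GRing.Lmodule.on homology_of.
End HomologyOf.

End Modules.

Section Chains.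
Variables (X : sset) (E : effective X) (T : pred (X 1%N)).
Local Notation G := (pi1 E T).

Definition nd_simp n : choiceType := seq_sub (nd E n).

Definition chain n : lmodType (group_ring G) := free_mod G (nd_simp n).

(* Degenerate simplices are zero in the normalized chains. *)
Definition chain_of n (y : cover E T n) : chain n :=
  if insub y.2 is Some s then fm_elt (y.1, s) else 0.

Definition bd_simp n (y : G * nd_simp n.+1) : chain n :=
  \sum_(i < n.+2)
    chain_of (face i ((y.1, val y.2) : cover E T n.+1)) *~ (-1) ^+ i.

Definition bdS n : chain n.+1 -> chain n := zlift (@bd_simp n).

(* The differential out of degree n; it is 0 for n = 0. *)
Definition bd n : chain n -> chain n.-1 :=
  match n with
  | 0 => fun _ => 0
  | k.+1 => @bdS k
  end.

Lemma chain_ofZ n g (y : cover E T n) :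
  gr_elt g *: chain_of y = chain_of ((g * y.1)%g, y.2).
Proof.
rewrite /chain_of /=; case: insub => [s|]; last by rewrite scaler0.
exact: fm_eltZ.
Qed.

Lemma bd_simpZ n g (y : G * nd_simp n.+1) :
  bd_simp ((g * y.1)%g, y.2) = gr_elt g *: bd_simp y.
Proof.
rewrite /bd_simp scaler_sumr; apply: eq_bigr => i _.
rewrite (raddfMz ( *:%R (gr_elt g))) /= chain_ofZ.
congr (chain_of (_, _) *~ _) => /=.
by case: ifP; rewrite ?mulgA.
Qed.

Lemma bdS_is_zmod_morphism n : zmod_morphism (@bdS n).
Proof. exact: zlift_is_zmod_morphism. Qed.

HB.instance Definition _ n := GRing.isZmodMorphism.Build (chain n.+1) (chain n)
  (@bdS n) (@bdS_is_zmod_morphism n).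

Lemma bdSU n y : @bdS n (fm_elt y) = bd_simp y.
Proof. exact: zliftU. Qed.

Lemma bdS_is_linear n : linear (@bdS n).
Proof.
move=> a c c'; rewrite raddfD /=; congr (_ + _).
move: a c; elim/gr_sub_ind => [||a a' ha ha'] => [c|g|c].
- by rewrite !scale0r raddf0.
- elim/fm_sub_ind => [|y|c1 c2 h1 h2].
  + by rewrite !(scaler0, raddf0).
  + by rewrite fm_eltZ !bdSU bd_simpZ.
  + by rewrite scalerBr !raddfB /= h1 h2 -scalerBr.
- by rewrite !scalerBl raddfB /= ha ha'.
Qed.

Lemma bd_is_linear n : linear (@bd n).
Proof.
by case: n => [|n]; [move=> a c c'; rewrite scaler0 addr0 | exact: bdS_is_linear].
Qed.

HB.instance Definition _ n :=
  GRing.isLinear.Build (group_ring G) (chain n) (chain n.-1) *:%R (@bd n)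
    (@bd_is_linear n).

Definition homology n := homology_of (@bd n.+1) (@bd n).
HB.instance Definition _ n := GRing.Lmodule.on (homology n).
End Chains.

Section DirectProduct.
Variables (I : finType) (V : I -> zmodType).

Definition dprod : Type := {dffun forall i : I, V i}.
HB.instance Definition _ := Choice.copy dprod {dffun forall i : I, V i}.

Definition dprod_zero : dprod := [ffun i => 0 : V i].
Definition dprod_opp (x : dprod) : dprod := [ffun i => - (x : {dffun _}) i].
Definition dprod_add (x y : dprod) : dprod :=
  [ffun i => (x : {dffun _}) i + (y : {dffun _}) i].

Lemma dprod_addA : associative dprod_add.
Proof. by move=> x y z; apply/ffunP => i; rewrite !ffunE addrA. Qed.
Lemma dprod_addC : commutative dprod_add.
Proof. by move=> x y; apply/ffunP => i; rewrite !ffunE addrC. Qed.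
Lemma dprod_add0 : left_id dprod_zero dprod_add.
Proof. by move=> x; apply/ffunP => i; rewrite !ffunE add0r. Qed.
Lemma dprod_addN : left_inverse dprod_zero dprod_opp dprod_add.
Proof. by move=> x; apply/ffunP => i; rewrite !ffunE addNr. Qed.

HB.instance Definition _ :=
  GRing.isZmodule.Build dprod dprod_addA dprod_addC dprod_add0 dprod_addN.
End DirectProduct.

Section CyclicSum.
Variables (l f : nat) (t : 'I_l -> nat).

(* Z/t_1 + ... + Z/t_l + Z^f.  Z/m is 'I_m.-1.+1, that is 'I_m when 0 < m,
   with addition modulo m. *)
Definition cyclic_sum : zmodType :=
  (dprod (fun i : 'I_l => 'I_(t i).-1.+1) * {ffun 'I_f -> int})%type.

(* The generator of the i-th summand, for 'I_(l + f) listing first the l finite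
   summands and then the f infinite ones. *)
Definition cyclic_gen (i : 'I_(l + f)) : cyclic_sum :=
  match split i with
  | inl i0 => ([ffun k : 'I_l => if k == i0 then inZp 1 else 0], 0)
  | inr i0 => (0, [ffun k : 'I_f => (k == i0)%:R])
  end.
End CyclicSum.

Section IdealGenerated.
Variables (A : comNzRingType) (s : seq A).

Definition ideal_gen : {pred A} :=
  fun a => `[< exists c : 'I_(size s) -> A, a = \sum_i c i * s`_i >].

Lemma ideal_gen_closed :
  0 \in ideal_gen /\
  forall a, {in ideal_gen &, forall u v, a * u + v \in ideal_gen}.
Proof.
split=> [|a _ _ /asboolP[c ->] /asboolP[c' ->]]; apply/asboolP.
  by exists (fun=> 0); rewrite big1 // => i _; rewrite mul0r.
exists (fun i => a * c i + c' i); rewrite mulr_sumr -big_split /=.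
by apply: eq_bigr => i _; rewrite mulrDl mulrA.
Qed.
End IdealGenerated.

Section LaurentQuotient.
Variables (l f : nat) (t : 'I_l -> nat).

(* R = Z[x_1, xbar_1, ..., x_(l+f), xbar_(l+f)]. *)
Local Notation R := {mpoly int[(l + f) + (l + f)]}.

Definition xvar (i : 'I_(l + f)) : R := 'X_(lshift (l + f) i).
Definition xbar (i : 'I_(l + f)) : R := 'X_(rshift (l + f) i).

Definition I_gens : seq R :=
  [seq xvar i * xbar i - 1 | i <- enum 'I_(l + f)]
  ++ [seq xvar (lshift f i) ^+ t i - 1 | i <- enum 'I_l].

Definition I_pred : {pred R} := ideal_gen I_gens.

(* I is proper: all its elements vanish when every variable is set to 1. *)
Lemma I_closed : idealr_closed I_pred.
Proof.
have [I0 IP] := ideal_gen_closed I_gens; split=> //.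
apply/negP => /asboolP[c] /(congr1 (meval (fun=> 1))).
rewrite meval1 raddf_sum big1 /= => [/eqP|i _]; first by rewrite oner_eq0.
rewrite mevalM [X in _ * X](_ : _ = 0) ?mulr0 //.
have := mem_nth 0 (ltn_ord i); rewrite mem_cat => /orP[] /mapP[k _ ->].
  by rewrite mevalB mevalM !mevalXU meval1 mulr1 subrr.
by rewrite mevalB rmorphXn /= mevalXU meval1 expr1n subrr.
Qed.

HB.instance Definition _ := isIdealr.Build R I_pred I_closed.

Definition RmodI : comNzRingType := {ideal_quot I_pred}.

Definition xclass (i : 'I_(l + f)) : RmodI := \pi_({ideal_quot I_pred}) (xvar i).
End LaurentQuotient.

Section BoundaryMatrix.
Variables (X : sset) (E : effective X) (T : pred (X 1%N)) (B : comNzRingType).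
Variable nu : group_ring (pi1 E T) -> B.

Definition nd_count q := size (nd E q).
Definition sigma q (i : 'I_(nd_count q)) : X q := tnth (in_tuple (nd E q)) i.

Definition bdmxS q : 'M[B]_(nd_count q, nd_count q.+1) :=
  \matrix_(i, j)
    (\sum_(d < q.+1 | face (widen_ord (leqnSn _) d) (sigma j) == sigma i)
        (-1) ^+ d
     + if face ord_max (sigma j) == sigma i
       then (-1) ^+ q.+1 * nu (gr_elt (tau E T (sigma j))^-1%g) else 0).

Definition bdmx q : 'M[B]_(nd_count q.-1, nd_count q) :=
  match q with
  | 0 => 0
  | k.+1 => bdmxS k
  end.
End BoundaryMatrix.

Definition generates_rker (B : nzRingType) m k p (M : 'M[B]_(m, k))
    (N : 'M[B]_(k, p)) : Prop :=
  forall v : 'cV[B]_k, M *m v = 0 <-> exists w : 'cV[B]_p, v = N *m w.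

(* B^p modulo the submodule generated by the rows of P. *)
Definition row_quot (B : nzRingType) r p (P : 'M[B]_(r, p)) : lmodType B :=
  quot_mod (im_pred (mulmxr P : {linear 'rV[B]_r -> 'rV[B]_p})).

(* P is a presentation matrix of the A-module H, its coefficient ring B being
   identified with A through nu. *)
Definition presentation_matrix (A B : nzRingType) (nu : {rmorphism A -> B})
    r p (P : 'M[B]_(r, p)) (H : lmodType A) : Prop :=
  exists phi : {linear H -> row_quot P | nu \; *:%R}, bijective phi.

(* Main.v *)
(* Through nu, the normalized chains of the universal cover are free R/I-modules
   in which the differentials are multiplication by the matrices M^q.  Hence
   M^n M^(n+1) = 0, and the cycles, being the kernel of M^n, are a quotient of
   (R/I)^p by the map N; its kernel is the column space of R2, and the
   boundaries, being the image of M^(n+1) = N R1, lift to the columns of R1. *)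

From HB Require Import structures.
From mathcomp Require Import all_boot all_order all_algebra.
From mathcomp Require Import boolp.
Require Import Defs.

Set Implicit Arguments.
Unset Strict Implicit.
Unset Printing Implicit Defensive.

Import GRing.Theory.
Local Open Scope ring_scope.

(** * Homology in coordinates *)

Lemma in_im_pred (R : nzRingType) (U V : lmodType R) (f : {linear U -> V}) v :
  v \in im_pred f <-> exists u, v = f u.
Proof. by split=> /asboolP. Qed.

(* The isomorphism sends the class of a cycle with coordinates N w to the class
   of w^T. *)
Lemma homology_presentation (A : nzRingType) (B : comNzRingType)
    (nu : {rmorphism A -> B}) (U V W : lmodType A)
    (g : {linear U -> V}) (f : {linear V -> W}) (m k q p r : nat)
    (cU : {linear U -> 'cV[B]_m | nu \; *:%R})
    (cV : {linear V -> 'cV[B]_k | nu \; *:%R})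
    (cW : {linear W -> 'cV[B]_q | nu \; *:%R})
    (Mg : 'M[B]_(k, m)) (Mf : 'M[B]_(q, k))
    (N : 'M[B]_(k, p)) (R1 : 'M[B]_(p, m)) (R2 : 'M[B]_(p, r)) :
  (forall v, exists u, cU u = v) -> bijective cV -> injective cW ->
  (forall u, cV (g u) = Mg *m cU u) -> (forall v, cW (f v) = Mf *m cV v) ->
  generates_rker Mf N -> Mg = N *m R1 -> generates_rker N R2 ->
  presentation_matrix nu (col_mx R1^T R2^T) (homology_of g f).
Proof.
move=> surU [cV' cVK cV'K] injW cVg cWf kerN MgE kerR2.
pose H : lmodType A := homology_of g f; pose P := col_mx R1^T R2^T.
pose Q := row_quot P.
pose kpi (z : ker f) : H := quot_pi (bound_pred g (f := f)) z.
pose qpi (w : 'rV[B]_p) : Q :=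
  quot_pi (im_pred (mulmxr P : {linear 'rV[B]_(m + r) -> 'rV[B]_p})) w.
have kpi_surj x : exists z, x = kpi z.
  by exists (repr (x : {ideal_quot (submod_pred (bound_pred g (f := f)))}));
    rewrite /kpi quot_pi_repr.
have qpi_surj y : exists w, y = qpi w^T.
  exists (repr (y : {ideal_quot (submod_pred (im_pred (mulmxr P :
    {linear 'rV[B]_(m + r) -> 'rV[B]_p})))}))^T.
  by rewrite trmxK /qpi quot_pi_repr.
(* Equality in both quotients is reduced to one condition, that a difference lie in the image of
   [Mg]; comparing [qpiE] with [kpiE] makes the map well defined and injective. Here [N] kills the
   columns of [R2] and carries [R1] to [Mg]. *)
have qpiE w w' : qpi w^T = qpi w'^T <-> exists u, N *m (w - w') = Mg *m u.
  split=> [/quot_piP/in_im_pred[u /= /(congr1 trmx)]|[u hu]].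
    rewrite -[u]hsubmxK mul_row_col linearB linearD /= !trmx_mul !trmxK => ->.
    exists (lsubmx u)^T; rewrite mulmxDr MgE !mulmxA.
    suff -> : N *m R2 *m (rsubmx u)^T = 0 by rewrite addr0.
    by rewrite -mulmxA; apply/kerR2; exists (rsubmx u)^T.
  have /kerR2[v hv] : N *m (w - w' - R1 *m u) = 0.
    by rewrite mulmxBr hu MgE mulmxA subrr.
  apply/quot_piP/in_im_pred; exists (row_mx u^T v^T) => /=.
  rewrite mul_row_col -!trmx_mul -hv -!linearB /= -linearD /=.
   by rewrite [R1 *m u + _]addrC subrK.
have kpiE (z z' : ker f) :
    kpi z = kpi z' <-> exists u, cV (ker_val z) - cV (ker_val z') = Mg *m u.
  split=> [/quot_piP|[u hu]].
    rewrite unfold_in /bound_pred => /in_im_pred[u hu].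
    by exists (cU u); rewrite -cVg -hu -linearB.
  apply/quot_piP; rewrite unfold_in /bound_pred; apply/in_im_pred.
  have [u' hu'] := surU u; exists u'; apply: (can_inj cVK).
  by rewrite cVg hu' -hu -linearB.
have ker_coord (z : ker f) : exists w, cV (ker_val z) = N *m w.
  by apply/kerN; rewrite -cWf; case: z => z /= /eqP->; rewrite raddf0.
(* Neither the cycle nor its lift through [N] is canonical, so the map is chosen from a relation;
   [phiE] shows that its value is independent of both. *)
have exphi x : exists y, exists z w,
    [/\ x = kpi z, cV (ker_val z) = N *m w & y = qpi w^T].
  have [z ->] := kpi_surj x; have [w hw] := ker_coord z.
  by exists (qpi w^T), z, w.
have [phi phiP] := choice exphi.
have phiE z w : cV (ker_val z) = N *m w -> phi (kpi z) = qpi w^T.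
  move=> hw; have [z' [w' [/kpiE[u zz] hw' ->]]] := phiP (kpi z).
  apply/qpiE; exists (- u).
  by rewrite mulmxN -zz opprB mulmxBr hw hw'.
have phi_linear : linear_for (nu \; *:%R) phi.
  move=> a x y; have [z ->] := kpi_surj x; have [z' ->] := kpi_surj y.
  have [w hw] := ker_coord z; have [w' hw'] := ker_coord z'.
  rewrite -[_ + _]/(a *: (quot_pi _ z) + quot_pi _ z') -linearP.
  rewrite (phiE (a *: z + z') (nu a *: w + w')); last first.
    by rewrite -[ker_val (_ + _)]/(val (a *: z + z')) !linearP /= hw hw'.
  by rewrite (phiE _ _ hw) (phiE _ _ hw') /qpi [trmx _]linearP linearP.
have phi_inj : injective phi.
  move=> x y; have [z ->] := kpi_surj x; have [z' ->] := kpi_surj y.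
  have [w hw] := ker_coord z; have [w' hw'] := ker_coord z'.
  rewrite (phiE _ _ hw) (phiE _ _ hw') => /qpiE[u hu].
  by apply/kpiE; exists u; rewrite hw hw' -mulmxBr.
have phi_surj y : exists x, phi x = y.
  have [w ->] := qpi_surj y.
  (* Injectivity of [cW] lets the cycle condition be checked on coordinates, where [Mf] kills
     [N *m w]. *)
  have kz : cV' (N *m w) \in ker_pred f.
    apply/eqP/injW; rewrite cWf cV'K raddf0.
    by apply/kerN; exists w.
  by exists (kpi (Ker kz)); apply: phiE; rewrite /= cV'K.
have [phi' phi'K] := choice phi_surj.
pose L := GRing.isLinear.Build A H Q (nu \; *:%R) phi phi_linear.
pose phiL : {linear H -> Q | nu \; *:%R} := HB.pack phi L.
exists phiL; exists phi' => // x; apply: phi_inj; exact: phi'K.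
Qed.

(** * Coordinates of chains through [nu] *)

Section Coordinates.
Variables (X : sset) (E : effective X) (T : pred (X 1%N)) (B : comNzRingType).
Local Notation G := (pi1 E T).
Variable nu : {rmorphism group_ring G -> B}.

Definition simp_coord n (y : G * nd_simp E n) : 'cV[B]_(nd_count E n) :=
  \col_i (nu (gr_elt y.1) *+ (sigma i == val y.2)).

Definition chain_coord n (c : chain E T n) : 'cV[B]_(nd_count E n) :=
  zlift (@simp_coord n) c.

Lemma chain_coord_is_zmod_morphism n : zmod_morphism (@chain_coord n).
Proof. exact: zlift_is_zmod_morphism. Qed.

HB.instance Definition _ n := GRing.isZmodMorphism.Build
  (chain E T n) 'cV[B]_(nd_count E n) (@chain_coord n)
  (@chain_coord_is_zmod_morphism n).

Lemma chain_coordU n y : @chain_coord n (fm_elt y) = simp_coord y.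
Proof. exact: zliftU. Qed.

Lemma chain_coord_is_linear n : linear_for (nu \; *:%R) (@chain_coord n).
Proof.
move=> a c c'; rewrite raddfD /=; congr (_ + _).
move: a c; elim/gr_sub_ind => [||a a' ha ha'] => [c|g|c].
- by rewrite scale0r rmorph0 scale0r raddf0.
- elim/fm_sub_ind => [|y|c1 c2 h1 h2].
  + by rewrite !(scaler0, raddf0).
  + rewrite fm_eltZ !chain_coordU; apply/colP => i; rewrite !mxE /=.
    by rewrite gr_eltM rmorphM mulrnAr.
  + by rewrite scalerBr !raddfB /= h1 h2 -scalerBr.
- by rewrite scalerBl raddfB /= ha ha' rmorphB scalerBl.
Qed.

HB.instance Definition _ n := GRing.isLinear.Build (group_ring G)
  (chain E T n) 'cV[B]_(nd_count E n) (nu \; *:%R) (@chain_coord n)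
  (@chain_coord_is_linear n).

Lemma sigma_nd n (i : 'I_(nd_count E n)) : sigma i \in nd E n.
Proof. exact: mem_tnth. Qed.

Lemma sigma_inj n : injective (@sigma X E n).
Proof.
move=> i j; rewrite /sigma !(tnth_nth (sigma i)) /= => /eqP.
by rewrite nth_uniq ?nd_uniq // => /eqP/val_inj.
Qed.

Lemma sigma_surj n (s : nd_simp E n) : exists i, @sigma X E n i = val s.
Proof.
have /tnthP[i ->] : val s \in in_tuple (nd E n) by exact: valP.
by exists i.
Qed.

(** Degenerate simplices are covered too: their chain is zero, and no [sigma i] is degenerate. *)
Lemma chain_coord_of n (y : cover E T n) i :
  chain_coord (chain_of y) i 0 = nu (gr_elt y.1) *+ (y.2 == sigma i).
Proof.
rewrite /chain_of; case: insubP => [s _ sE|ys].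
  by rewrite chain_coordU mxE /= sE eq_sym.
rewrite raddf0 mxE; case: eqP => // yE.
by rewrite yE sigma_nd in ys.
Qed.

Lemma chain_coord_bij n : bijective nu -> bijective (@chain_coord n).
Proof.
move=> [nu' nuK nu'K].
have nu'B a b : nu' (a - b) = nu' a - nu' b.
  by apply: (can_inj nuK); rewrite rmorphB !nu'K.
have nu'0 : nu' 0 = 0 by apply: (can_inj nuK); rewrite rmorph0 nu'K.
(* The simplices over the identity of G form a basis, since [(g, s)] is g times [(1, s)]; the
   inverse expands a column in it, with entries pulled back by [nu']. *)
pose b (i : 'I_(nd_count E n)) : chain E T n :=
  fm_elt (1%g, SeqSub (sigma_nd i)).
have coordb i : chain_coord (b i) = delta_mx i 0.
  apply/colP => j; rewrite chain_coordU !mxE /= (inj_eq (@sigma_inj _)).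
  by rewrite rmorph1 andbT.
exists (fun v : 'cV[B]_(nd_count E n) => \sum_i nu' (v i 0) *: b i)
  => [c|v]; last first.
  rewrite raddf_sum [RHS]matrix_sum_delta; apply: eq_bigr => i _.
  by rewrite big_ord1 /= linearZ /= nu'K coordb.
elim/fm_sub_ind: c => [|[g s]|c c' hc hc'].
- by rewrite raddf0 big1 // => i _; rewrite mxE nu'0 scale0r.
- have [j js] := sigma_surj s; rewrite chain_coordU (bigD1 j) //= big1.
    rewrite addr0 mxE js eqxx mulr1n nuK fm_eltZ mulg1; congr (fm_elt (_, _)).
    exact/val_inj.
  by move=> i ij; rewrite mxE -js (inj_eq (@sigma_inj _)) (negPf ij)
    nu'0 scale0r.
- rewrite -[in RHS]hc -[in RHS]hc' -sumrB; apply: eq_bigr => i _.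
  by rewrite raddfB !mxE nu'B scalerBl.
Qed.

(* The last face multiplies g by tau^-1 on the right while the entry of the
   matrix acts on the left, hence the commutativity of G. *)
Lemma chain_coord_bdS n (c : chain E T n.+1) :
  (forall x y : G, (x * y = y * x)%g) ->
  chain_coord (bdS c) = bdmxS nu n *m chain_coord c.
Proof.
move=> abG; elim/fm_sub_ind: c => [|[g s]|c c' hc hc'].
- by rewrite !raddf0.
- have [j js] := sigma_surj s.
  rewrite bdSU chain_coordU; apply/colP => i.
  rewrite mxE (bigD1 j) //= big1 ?addr0 => [|j' jj']; last first.
    rewrite [X in _ * X]mxE -js (inj_eq (@sigma_inj _)) (negPf jj').
    by rewrite mulr0.
  rewrite [X in _ * X]mxE -js eqxx mulr1n mxE /bd_simp -js.
  (* The last face is split off, being the only one twisted by [tau]. *)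
  rewrite raddf_sum summxE big_ord_recr /= mulrDl mulr_suml; congr (_ + _).
    rewrite [RHS]big_mkcond; apply: eq_bigr => d _.
    rewrite raddfMz -scaler_int mxE chain_coord_of /= -val_eqE /= ltn_eqF //.
    by case: eqP => _; rewrite ?mulr0 ?mul0r // rmorph_sign.
  rewrite raddfMz -scaler_int mxE chain_coord_of /= eqxx.
  case: eqP => _; rewrite ?mulr0 ?mul0r // rmorph_sign -mulrA.
  by rewrite -rmorphM -gr_eltM abG.
- by rewrite !raddfB /= hc hc' -mulmxBr.
Qed.
End Coordinates.

(** * The differential squares to zero *)

(** The terms with j < i cancel those with i <= j: the identity d_a d_(b+1) = d_b d_a for a <= b
    pairs them with opposite signs. *)
Lemma sum_face_face (Y : sset) (V : zmodType) n (F : Y n -> V) (y : Y n.+2) :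
  \sum_(i < n.+3) (\sum_(j < n.+2) F (face j (face i y)) *~ (-1) ^+ j)
    *~ (-1) ^+ i = 0.
Proof.
pose t (i : 'I_n.+3) (j : 'I_n.+2) := F (face j (face i y)) *~ (-1) ^+ (i + j).
transitivity (\sum_(j < n.+2) \sum_(i < n.+3) t i j).
  rewrite exchange_big; apply: eq_bigr => i _ /=; rewrite mulrz_suml.
  by apply: eq_bigr => j _; rewrite -mulrzA -exprD addnC.
pose s (a b : 'I_n.+2) := t (widen_ord (leqnSn _) a) b.
have tE (a b : 'I_n.+2) : (a <= b)%N -> t (fintype.lift ord0 b) a = - s a b.
  move=> ab; rewrite /s /t face_face //= /bump leq0n add1n addSn exprS.
  by rewrite mulN1r mulrNz addnC.
transitivity (\sum_(j < n.+2) (\sum_(b < n.+2 | (j <= b)%N) - s j b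
                               + \sum_(a < n.+2 | (a <= j)%N) s a j)).
  apply: eq_bigr => j _; rewrite (bigID (fun i : 'I_n.+3 => (j < i)%N)) /=.
  congr (_ + _).
    rewrite big_mkcond big_ord_recl /= add0r [RHS]big_mkcond.
    by apply: eq_bigr => b _; rewrite /= /bump add1n ltnS; case: ifP => // /tE.
  rewrite big_mkcond big_ord_recr /= ltn_ord addr0 [RHS]big_mkcond.
  by apply: eq_bigr => a _ /=; rewrite -leqNgt.
rewrite big_split /= [X in _ + X](exchange_big_dep xpredT) //= -big_split /=.
by rewrite big1 // => a _; rewrite sumrN addNr.
Qed.

(** Faces j and j + 1 of s_j z both equal z and have opposite signs; every other face is degenerate,
    hence killed by [F]. *)
Lemma sum_face_degen (Y : sset) (V : zmodType) n (F : Y n -> V)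
    (j : 'I_n.+1) (z : Y n) :
  (forall y, degenerate y -> F y = 0) ->
  \sum_(i < n.+2) F (face i (degen j z)) *~ (-1) ^+ i = 0.
Proof.
move=> F0; pose jw := widen_ord (leqnSn _) j; pose jl := fintype.lift ord0 j.
have jlw : jl != jw by rewrite -val_eqE /= /bump add1n gtn_eqF.
rewrite (bigD1 jw) //= (bigD1 jl) //= big1 ?addr0 => [|i /andP[iw il]].
  rewrite !face_degen_id ?eqxx ?orbT // /bump add1n exprS mulN1r mulrNz.
  exact: subrr.
rewrite F0 ?mul0rz //.
(* In dimension 0 there is no other face. Above it, d_i s_j is s_(j-1) d_i for i < j and s_j d_(i-1)
   for i > j + 1. *)
case: n F F0 j z @jw @jl {jlw} i iw il => [|n] F F0 j z jw jl i iw il.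
  by case: i iw il => -[|[|]] // hi; rewrite -?val_eqE /= ord1.
have {}iw : i != j :> nat by rewrite -val_eqE in iw.
have {}il : i != j.+1 :> nat by rewrite -val_eqE /= /bump add1n in il.
have [ij|ji] := ltnP i j.
  have jn : (j.-1 < n.+1)%N by case: (j) ij => -[|k].
  have i_n : (i < n.+2)%N by exact: leq_trans ij (ltnW (ltn_ord j)).
  rewrite (_ : j = fintype.lift ord0 (Ordinal jn)); last first.
    by apply/val_inj; rewrite /= /bump add1n prednK //; case: (val j) ij.
  rewrite (_ : i = widen_ord (leqnSn _) (Ordinal i_n)); last exact/val_inj.
  rewrite face_degen_lt; first by do 2 eexists.
  by rewrite /= -ltnS prednK //; case: (val j) ij.
have {il iw}ji : (j.+1 < i)%N.
  by rewrite ltn_neqAle eq_sym il ltn_neqAle eq_sym iw.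
have jn : (j < n.+1)%N by rewrite -ltnS -ltnS; exact: leq_trans ji (ltn_ord i).
have i_n : (i.-1 < n.+2)%N by case: (i) ji => -[|k].
rewrite (_ : i = fintype.lift ord0 (Ordinal i_n)); last first.
  by apply/val_inj; rewrite /= /bump add1n prednK //; case: (val i) ji.
rewrite (_ : j = widen_ord (leqnSn _) (Ordinal jn)); last exact/val_inj.
rewrite face_degen_gt; first by do 2 eexists.
by rewrite /= -ltnS prednK //; case: (val i) ji.
Qed.

Section ChainComplex.
Variables (X : sset) (E : effective X) (T : pred (X 1%N)).

Lemma chain_of_degenerate n (y : cover E T n) : degenerate y -> chain_of y = 0.
Proof.
case: n y => // n y [i [z ->]]; rewrite /chain_of insubF //.
by apply/negP => /mem_nd; apply; exists i, z.2.
Qed.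

(** Faces of a non-degenerate simplex may be degenerate, so iterating the differential needs its
    formula there as well; both sides then vanish. *)
Lemma bdS_chain_of n (y : cover E T n.+1) :
  bdS (chain_of y) = \sum_(i < n.+2) chain_of (face i y) *~ (-1) ^+ i.
Proof.
have [yE|yE] := boolP (y.2 \in nd E n.+1).
  rewrite [in LHS]/chain_of insubT bdSU /bd_simp /=.
  by apply: eq_bigr => i _; case: y yE.
have [j [x yx]] : degenerate y.2.
  by apply: contrapT => /(mem_nd E) yE'; rewrite yE' in yE.
rewrite (_ : y = degen j ((y.1, x) : cover E T n)); last first.
  by case: y yx {yE} => g x' /= ->.
rewrite chain_of_degenerate ?raddf0; last by do 2 eexists.
rewrite sum_face_degen //; exact: chain_of_degenerate.
Qed.

(** The twisted faces satisfy the simplicial identities of [cover], so the usual cancellation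
    applies there. *)
Lemma bdS_bdS n (c : chain E T n.+2) : bdS (bdS c) = 0.
Proof.
elim/fm_sub_ind: c => [|[g s]|c c' hc hc']; first by rewrite !raddf0.
  rewrite bdSU /bd_simp raddf_sum -[RHS](sum_face_face (@chain_of X E T n)
    ((g, val s) : cover E T n.+2)).
  by apply: eq_bigr => i _; rewrite raddfMz /= bdS_chain_of.
by rewrite !raddfB /= hc hc' subrr.
Qed.

End ChainComplex.

(** * Factorization through [N] and conclusion *)

(** Applied to the basis vectors, the hypothesis lifts each column of [M]; the lifts are the columns
    of [R1]. *)
Lemma matrix_factors (B : nzRingType) m k p (M : 'M[B]_(k, m))
    (N : 'M[B]_(k, p)) :
  (forall v : 'cV[B]_m, exists w : 'cV[B]_p, M *m v = N *m w) ->
  exists R1 : 'M[B]_(p, m), M = N *m R1.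
Proof.
move=> MN; have [w wP] := choice (fun j => MN (delta_mx j 0)).
exists (\matrix_(i, j) w j i 0); apply/matrixP => i j.
have := congr1 (fun A : 'cV[B]_k => A i 0) (wP j).
rewrite -colE !mxE => ->.
by apply: eq_bigr => a _; rewrite mxE.
Qed.

Theorem mainTheorem5
  (X : sset) (E : effective X) (T : pred (X 1%N)) (n : nat)
  (connX : connected X) (treeT : maximal_tree T) (n_gt0 : (0 < n)%N)
  (abG : forall x y : pi1 E T, (x * y = y * x)%g)
  (* G = Z/t_1 + ... + Z/t_l + Z^f *)
  (l f : nat) (t : 'I_l -> nat) (t_gt0 : forall i, (0 < t i)%N)
  (iso : pi1 E T -> cyclic_sum f t)
  (iso_bij : bijective iso)
  (isoM : forall x y : pi1 E T, iso (x * y)%g = iso x + iso y)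
  (* the ring isomorphism nu : Z[G] -> R/I *)
  (nu : {rmorphism group_ring (pi1 E T) -> RmodI f t})
  (nu_bij : bijective nu)
  (nu_gen : forall (g : pi1 E T) (i : 'I_(l + f)),
     iso g = cyclic_gen t i -> nu (gr_elt g) = xclass t i)
  (p : nat) (N : 'M[RmodI f t]_(nd_count E n, p))
  (kerM : generates_rker (bdmx nu n) N) :
  (exists R1 : 'M[RmodI f t]_(p, nd_count E n.+1), bdmx nu n.+1 = N *m R1)
  /\ (forall (R1 : 'M[RmodI f t]_(p, nd_count E n.+1)),
        bdmx nu n.+1 = N *m R1 ->
      forall (r : nat) (R2 : 'M[RmodI f t]_(p, r)),
        generates_rker N R2 ->
        presentation_matrix nu (col_mx R1^T R2^T) (homology E T n)).
Proof.
(* With n a successor, [bd] and [bdmx] in degrees n and n + 1 unfold to [bdS] and [bdmxS]. *)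
case: n n_gt0 N kerM => // n _ N kerM.
have coordB m c := @chain_coord_bdS X E T _ nu m c abG.
have bijC := chain_coord_bij _ nu_bij.
split.
  apply: matrix_factors => v; apply/kerM.
  (* Every column is the coordinate vector of a chain, so the product of consecutive matrices
     vanishes because the differential squares to zero. *)
  have [c' _ cK] := bijC n.+2; rewrite -[v]cK.
  by rewrite /= -!coordB bdS_bdS raddf0.
move=> R1 R1E r R2 kerR2.
apply: (homology_presentation (cU := @chain_coord X E T _ nu n.+2)
  (cV := @chain_coord X E T _ nu n.+1) (cW := @chain_coord X E T _ nu n))
  kerM R1E kerR2.
- by move=> v; have [c' _ cK] := bijC n.+2; exists (c' v); exact: cK.
- exact: bijC.
- exact: bij_inj (bijC n).
- exact: coordB.
- exact: coordB.
Qed.
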